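(* Let $MNKL$ be the smallest area convex quadrilateral containing three efficiently packed unit disks, and let $P^{\ast}$ be the $2\times 6$ rectangle in which three unit disks are packed linearly. Then $\|MNKL\|>\|P^{\ast}\|$.
   Context: A unit disk is a closed disk of radius $1$ in $\mathbb{R}^2$, and $\|X\|$ denotes the area of a region $X\subset\mathbb{R}^2$. Three unit disks are efficiently packed (i.e. Wegner packed) if they are pairwise tangent with disjoint interiors, i.e. their centres $O_1,O_2,O_3$ satisfy $|O_1O_2|=|O_2O_3|=|O_3O_1|=2$. Thus $MNKL$ is a convex quadrilateral of minimum area among all convex quadrilaterals containing three such pairwise tangent unit disks. In $P^\ast$ the three disks are packed linearly: their centres lie on a line, consecutive ones at distance $2$; thus $\|P^\ast\|=12$. *)

(* Defs.v *)
From HB Require Import structures.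
From mathcomp Require Import all_boot all_order all_algebra.
From mathcomp Require Import all_classical all_reals all_analysis.

Set Implicit Arguments.
Unset Strict Implicit.
Unset Printing Implicit Defensive.

Import Order.TTheory GRing.Theory Num.Theory.

Local Open Scope classical_set_scope.
Local Open Scope ring_scope.

Notation plane R := (R * R)%type (only parsing).

(* The library's norm and balls on [R * R] are those of the sup norm, hence
   an explicit Euclidean distance. *)
Definition eucl_dist (R : realType) (p q : plane R) : R :=
  Num.sqrt ((p.1 - q.1) ^+ 2 + (p.2 - q.2) ^+ 2).

Definition unit_disk (R : realType) (c : plane R) : set (plane R) :=
  [set p | eucl_dist c p <= 1].

Definition area (R : realType) (X : set (plane R)) : \bar R :=
  ((@lebesgue_measure R \x @lebesgue_measure R) X)%E.

Definition segment (R : realType) (A B : plane R) : set (plane R) :=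
  [set p | exists t : R, 0 <= t <= 1 /\
     p = ((1 - t) * A.1 + t * B.1, (1 - t) * A.2 + t * B.2)].

(* Convex hull of four points. *)
Definition quad (R : realType) (A B C D : plane R) : set (plane R) :=
  [set p | exists a b c d : R,
     [/\ 0 <= a, 0 <= b, 0 <= c & 0 <= d] /\ a + b + c + d = 1 /\
     p = (a * A.1 + b * B.1 + c * C.1 + d * D.1,
          a * A.2 + b * B.2 + c * C.2 + d * D.2)].

(* Cross product (B - A) x (C - B): positive for a left turn at B along the
   path A, B, C, negative for a right turn. *)
Definition turn (R : realType) (A B C : plane R) : R :=
  (B.1 - A.1) * (C.2 - B.2) - (B.2 - A.2) * (C.1 - B.1).

(* A, B, C, D are the vertices, in cyclic order and in either orientation, of
   a convex quadrilateral: the boundary path turns strictly in the same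
   direction at all four vertices (so all angles lie strictly between 0 and
   pi). The quadrilateral as a closed region is then [quad A B C D]. *)
Definition convex_quadrilateral (R : realType) (A B C D : plane R) : Prop :=
  [/\ 0 < turn A B C, 0 < turn B C D, 0 < turn C D A & 0 < turn D A B] \/
  [/\ turn A B C < 0, turn B C D < 0, turn C D A < 0 & turn D A B < 0].

Definition efficiently_packed (R : realType) (O1 O2 O3 : plane R) : Prop :=
  [/\ eucl_dist O1 O2 = 2, eucl_dist O2 O3 = 2 & eucl_dist O3 O1 = 2].

Definition linearly_packed (R : realType) (O1 O2 O3 : plane R) : Prop :=
  [/\ segment O1 O3 O2, eucl_dist O1 O2 = 2 & eucl_dist O2 O3 = 2].

Definition contains_disks (R : realType) (X : set (plane R))
    (O1 O2 O3 : plane R) : Prop :=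
  [/\ unit_disk O1 `<=` X, unit_disk O2 `<=` X & unit_disk O3 `<=` X].

Definition contains_efficient_packing (R : realType) (X : set (plane R)) :
    Prop :=
  exists O1 O2 O3 : plane R,
    efficiently_packed O1 O2 O3 /\ contains_disks X O1 O2 O3.

(* Minimality ranges over the position of the packed disks as well as over
   the quadrilateral. *)
Definition smallest_quadrilateral (R : realType) (M N K L : plane R) : Prop :=
  [/\ convex_quadrilateral M N K L,
      contains_efficient_packing (quad M N K L) &
      forall M' N' K' L' : plane R,
        convex_quadrilateral M' N' K' L' ->
        contains_efficient_packing (quad M' N' K' L') ->
        (area (quad M N K L) <= area (quad M' N' K' L'))%E].

(* A parallelogram ABCD with a right angle at B, |AB| = h and |BC| = l. *)
Definition rectangle (R : realType) (h l : R) (A B C D : plane R) : Prop :=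
  [/\ D = (A.1 + C.1 - B.1, A.2 + C.2 - B.2),
      (B.1 - A.1) * (C.1 - B.1) + (B.2 - A.2) * (C.2 - B.2) = 0,
      eucl_dist A B = h & eucl_dist B C = l].

(* A 2 x 6 rectangle, in any position in the plane, containing three linearly
   packed unit disks. *)
Definition linear_packing_rectangle (R : realType) (P : set (plane R)) :
    Prop :=
  exists A B C D : plane R,
    [/\ rectangle 2 6 A B C D, P = quad A B C D &
        exists O1 O2 O3 : plane R,
          linearly_packed O1 O2 O3 /\ contains_disks P O1 O2 O3].

(* Main.v *)
Require Import Defs.
From mathcomp Require Import all_boot all_order all_algebra.
From mathcomp Require Import all_classical all_reals all_analysis.
From mathcomp Require Import measurable_realfun.
From mathcomp Require Import ring lra.

Set Implicit Arguments.
Unset Strict Implicit.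
Unset Printing Implicit Defensive.

Import Order.TTheory GRing.Theory Num.Theory numFieldNormedType.Exports.

Local Open Scope classical_set_scope.
Local Open Scope ring_scope.

(** Three pairwise tangent unit disks are the unit neighbourhoods of the vertices
    of a triangle T of side 2; write r for the square root of 3.  The proof shows
    that twice the area of any convex quadrilateral Q containing the disks is at
    least 12 + 7 r > 24 ([shoelace_packed_ge]), while the rectangle has area 12.

    Let u_1, ..., u_4 be the outward unit normals of Q in cyclic order, and h_i
    the support number, from the centroid of T, of the union of the disks in the
    direction u_i.  The lines at distance h_i with normal u_i bound a
    quadrilateral Q' tangent to the convex hull of the disks, and monotonicity of
    mixed areas gives area Q >= area Q' ([mixed_area_le]).

    Twice the area of Q' is a sum of four corner terms, one for each pair u, v of
    consecutive normals, namely s h_u + t h_v with s and t the lengths of the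
    tangents from the corner to the two touching points.  Directions fall into
    three sectors of 120 degrees, according to the vertex of T that is extreme;
    the borders are the normals of the sides of T.  A corner is cheap only if
    each border between u and v is close to one of them, while, were it not for
    the borders, four equal corners would be cheapest; four normals cannot follow
    the three borders and also turn by 90 degrees each time.

    This competition is resolved by a potential p(u), a function of the direction
    only: every corner term is at least
      p(v) - p(u) + k (4 + 10 r / 3) - 3 r / 4,
    where k is the number of borders from u to v ([corner_bound]).  Around Q' the
    potential cancels and at least three borders are crossed, so the four corner
    terms add up to at least 3 (4 + 10 r / 3) - 3 r = 12 + 7 r.

    The bound on a corner is a polynomial inequality in half-angle tangents, for
    k = 0, 1, 2.  On the measure side, [area_quad] identifies the product measure
    of a convex quadrilateral with the shoelace formula: shears preserve area, a
    shear makes one diagonal vertical, and then the length of the vertical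
    sections is piecewise affine. *)

(** * Polynomial inequalities behind the corner bounds *)

Lemma concave_quadratic_ge0 (R : realFieldType) (a b c lo hi x : R) :
  0 <= a -> lo <= x <= hi -> 0 <= c + b * lo - a * lo ^+ 2 ->
  0 <= c + b * hi - a * hi ^+ 2 -> 0 <= c + b * x - a * x ^+ 2.
Proof.
move=> a0 /andP[lx xh] flo fhi.
have [E|ne] := eqVneq lo hi.
  have -> : x = lo by apply/eqP; rewrite eq_le lx E xh.
  by [].
have d0 : 0 < hi - lo by rewrite subr_gt0 lt_neqAle ne (le_trans lx xh).
rewrite -(pmulr_rge0 _ d0).
have -> : (hi - lo) * (c + b * x - a * x ^+ 2) =
  (hi - x) * (c + b * lo - a * lo ^+ 2) + (x - lo) * (c + b * hi - a * hi ^+ 2)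
  + a * (x - lo) * (hi - x) * (hi - lo) by ring.
by rewrite !addr_ge0 // !mulr_ge0 // ?subr_ge0 // (le_trans lx xh).
Qed.

(** In this part P stands for 3 + y z and D for z - y, with y and z in [-1, 1]
    (or D = - t); the hypotheses are what remains of the range of y and z:
    4 - P - D = (1 + y) (1 - z), 4 - P + D = (1 - y) (1 + z) and
    D^2 + 4 P - 12 = (y + z)^2.  With q(y) = (3 y + y^3) / 2 one has
    q(z) - q(y) = D (D^2 + 3 P - 6) / 2, so each bound on q(z) - q(y) becomes an
    inequality between P and D, quadratic in P. *)
Lemma corner_poly0_ge0 (R : realFieldType) (P D : R) : 0 <= D <= 2 -> 2 <= P ->
  P + D <= 4 ->
  0 <= 24*D+9*P+24*D*P-12*D*P^+2-4*D^+3*P.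
Proof.
move=> /andP[D0 D2] h1 h2.
have := @concave_quadratic_ge0 R (12 * D) (9 + 24 * D - 4 * D ^+ 3) (24 * D) 2 (4 - D) P.
have H1 : 0 <= (2 - D) * (D * (D + 2)) by rewrite !mulr_ge0 //; lra.
have H2 : 0 <= (2 * D ^+ 2 - 7 * D + 23 / 4) ^+ 2 by exact: sqr_ge0.
have -> : 24*D+9*P+24*D*P-12*D*P^+2-4*D^+3*P = 24 * D + (9
  + 24 * D - 4 * D ^+ 3) * P - 12 * D * P ^+ 2 by ring.
apply; [lra | lra | nra | ].
(* At P = 4 - D the expression is a square plus a positive rest. *)
have -> : 24 * D + (9 + 24 * D - 4 * D ^+ 3) * (4 - D) - 12 * D * (4 - D) ^+ 2 =
  (2 * D ^+ 2 - 7 * D + 23 / 4) ^+ 2 + (47 / 16 - D / 2) by field.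
lra.
Qed.

(** The constant 51/5 is 6 times 17/10, a lower bound of 6 r.  For nonnegative D
    the expression is concave in P. *)
Lemma corner_poly1_ge0_pos (R : realFieldType) (P D : R) : 0 <= D <= 1 -> 2 <= P ->
  P + D <= 4 ->
  0 <= 3*(P+D) + 51/5*(4-P+D) - (P-3*D)*(D*(D^+2+3*P-6)/2+23/8).
Proof.
move=> /andP[D0 D1] h1 h2.
have := @concave_quadratic_ge0 R (3/2 * D) (-36/5 - D ^+ 3 / 2 + 3 * D - 23/8
  + 9 * D ^+ 2 / 2) (3 * D + 51/5 *(4+D) + 3*D*(D^+3/2-3*D+23/8)) 2 (4 - D) P.
have -> : 3*(P+D) + 51/5*(4-P+D) - (P-3*D)*(D*(D^+2+3*P-6)/2+23/8) = (3 * D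
  + 51/5 *(4+D) + 3*D*(D^+3/2-3*D+23/8)) + (-36/5 - D ^+ 3 / 2 + 3 * D - 23/8
  + 9 * D ^+ 2 / 2) * P - (3/2 * D) * P ^+ 2 by field.
apply; [lra | lra | |].
  nra.
nra.
Qed.

(** Here D = - t and concavity in P is lost; the expression is expanded around
    the upper end P = 4 - t instead. *)
Lemma corner_poly1_ge0_neg (R : realFieldType) (P t : R) : 0 <= t <= 2 ->
  12 <= t ^+ 2 + 4 * P -> P + t <= 4 ->
  0 <= 3*(P-t) + 51/5*(4-P-t) - (P+3*t)*(- t*(t^+2+3*P-6)/2+23/8).
Proof.
move=> /andP[D0 D1] h1 h2.
pose e := 4 - P - t.
have e0 : 0 <= e by rewrite /e; lra.
have e1 : e <= (1 - t / 2) ^+ 2 by rewrite /e; lra.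
have -> : P = 4 - t - e by rewrite /e; ring.
have H : 0 <= 1/2 + t/4-t^+3+t^+4 by nra.
have H2 : 0 <= 1/2 + t/4-t^+3+t^+4 + (1 - t / 2) ^+ 2 * (403/40-9*t-3/2*t^+2-t^+3/2).
   (* The expression is smallest, and about 0.44, near t = 11/10. *)
   have K : 0 <= 7/8*t^+2 - 13/40 * t + 41/5 by nra.
   have := mulr_ge0 (sqr_ge0 (t - 11/10)) K.
   have := sqr_ge0 (t - 2).
   have : 0 <= t ^+ 4 * (2 - t) by rewrite !mulr_ge0 ?exprn_ge0 //; lra.
   lra.
have H3 : 0 <= 3/2 * t * e ^+ 2 by rewrite !mulr_ge0 ?sqr_ge0 //; lra.
have [c0|c0] := lerP 0 (403/40-9*t-3/2*t^+2-t^+3/2).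
  have := mulr_ge0 e0 c0.  lra.
have : ((1 - t / 2) ^+ 2 - e) * (403/40-9*t-3/2*t^+2-t^+3/2) <= 0.
  by apply: mulr_ge0_le0; lra.
lra.
Qed.

Lemma corner_poly2_ge0 (R : realFieldType) (P t : R) : 0 <= t <= 2 ->
  12 <= t ^+ 2 + 4 * P -> P + t <= 4 ->
  0 <= 3*(P+t) - (3*t-P)*(- t*(t^+2+3*P-6)/2+55/8).
Proof.
move=> /andP[D0 D1] h1 h2.
have := @concave_quadratic_ge0 R (3/2 * t) (3 + (55/8+3*t-t^+3/2)
  + 9*t^+2/2) (3*t-3*t*(55/8+3*t-t^+3/2)) (3-t^+2/4) (4 - t) P.
have -> : 3*(P+t) - (3*t-P)*(- t*(t^+2+3*P-6)/2+55/8) = (3*t-3*t*(55/8+3*t-t^+3/2))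
  + (3 + (55/8+3*t-t^+3/2) + 9*t^+2/2) * P - (3/2 * t) * P ^+ 2 by field.
apply; [lra | lra | |].
  have [t1|t1] := lerP t 1.
    have := exprn_ge0 4 D0; have := exprn_ge0 5 D0; have := sqr_ge0 t; lra.
  (* Tangents of t^4 and t^5 at t = 2, where the bound is tightest. *)
  have K4 : 0 <= (t - 2) ^+ 2 * (t ^+ 2 + 4 * t + 12) by rewrite mulr_ge0 ?sqr_ge0 //; nra.
  have K5 : 0 <= (t - 2) ^+ 2 * (t ^+ 3 + 4 * t ^+ 2 + 12 * t + 32).
    by rewrite mulr_ge0 ?sqr_ge0 // !addr_ge0 ?mulr_ge0 ?exprn_ge0.
  have := sqr_ge0 (t - 2).
  lra.
nra.
Qed.

(** * Directions, supporting disks and the potential *)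

Section Vec.
Variable R : rcfType.
Implicit Types (p q u v w O : R * R) (a b y z : R).
Let r : R := Num.sqrt 3.

Lemma sqrt3_sqr : r ^+ 2 = 3. Proof. by rewrite sqr_sqrtr. Qed.

Lemma sqrt3_gt0 : 0 < r. Proof. by rewrite sqrtr_gt0. Qed.

Definition dot p q : R := p.1 * q.1 + p.2 * q.2.
Definition cross p q : R := p.1 * q.2 - p.2 * q.1.
(** The vector (a + b r i) w in complex notation.  Putting the factor r in the
    definition makes the coordinates of all vectors met below rational
    functions: the rotations by 120 degrees are (-1/2, +-1/2). *)
Definition frame w a b : R * R :=
  (a * w.1 - b * Num.sqrt 3 * w.2, a * w.2 + b * Num.sqrt 3 * w.1).

Lemma dot_frame w a b a' b' : dot w w = 1 ->
  dot (frame w a b) (frame w a' b') = a * a' + 3 * b * b'.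
Proof.
move=> w1; rewrite -sqrt3_sqr -[RHS]mulr1 -w1 /dot /frame /= -/r; ring.
Qed.

Lemma cross_frame w a b a' b' : dot w w = 1 ->
  cross (frame w a b) (frame w a' b') = r * (a * b' - b * a').
Proof.
move=> w1; rewrite -[RHS]mulr1 -w1 /dot /cross /frame /= -/r; ring.
Qed.

Lemma frame_frame w a b a' b' :
  frame (frame w a b) a' b' = frame w (a * a' - 3 * b * b') (a * b' + b * a').
Proof. by rewrite -sqrt3_sqr /frame /= -/r; congr pair; ring. Qed.

(** Take unit vectors u and v and the tangents, with these normals, to the unit
    disks centred at O and O'.  Divided by [cross u v], [leg_num O u O' v] is the
    distance from the point O + u where the first tangent touches to the
    intersection of both (see [tangent_vertex]). *)
Definition leg_num O u O' v := 1 + (dot O' v - dot O v) - dot u v.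

(** The corner region, seen from the origin, is cut along the segments from the
    origin to the centres and from the centres to the touching points; beside the
    terms depending on one direction only there remain a triangle on the segment
    from O to O', a kite of area (1 - cos) / sin, and two strips of width 1 and a
    triangle, which vanish for O = O'. *)
Lemma corner_identity O u O' v : dot u u = 1 -> dot v v = 1 -> cross u v != 0 ->
  let mv := dot O' v - dot O v in let mu := dot O u - dot O' u in
  (leg_num O u O' v * (1 + dot O u) + leg_num O' v O u * (1 + dot O' v)) / cross u v =
  cross O' v - cross O u + cross O O' + 2 * ((1 - dot u v) / cross u v)
  + 2 * ((mu + mv) / cross u v) + mu * mv / cross u v.
Proof.
move=> u1 v1 S0 mv mu.
suff E : leg_num O u O' v * (1 + dot O u) + leg_num O' v O u * (1 + dot O' v) =
   (cross O' v - cross O u + cross O O') * cross u v + 2 * (1 - dot u v) + 2 * (mu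
     + mv) + mu * mv.
  by rewrite E; field.
apply/eqP; rewrite -subr_eq0; apply/eqP.
transitivity ((1 - dot u u) * dot O v + (1 - dot v v) * dot O' u).
  rewrite /mu /mv /leg_num /dot /cross; ring.
by rewrite u1 v1; ring.
Qed.

(** The triangle of the three centres has circumradius 2 / r; w is the unit vector
    from its centroid towards the vertex in question. *)
Definition disk_center w := frame w (2 * r / 3) 0.
(** The unit vector at angle theta from w, where y = r tan (theta / 2): the range
    -1 <= y <= 1 is the sector of 120 degrees around w. *)
Definition normal_at w y := frame w ((3 - y ^+ 2) / (3 + y ^+ 2)) (2 * y / (3 + y ^+ 2)).
(** The first summand collects the terms of [corner_identity] that depend on one
    direction only.  The second one is dictated by the corners of the cheapest
    circumscribed trapezoids, whose normals have y = -1, 0 or 1 and whose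
    corners turn by 60 or 120 degrees: it takes there the values for which all
    these corners exceed the increase of the potential by the same amount.  With
    the linear function of y through these values the corners that turn by about
    90 degrees within one sector would be too cheap, hence the cubic term. *)
Definition potential w y := cross (disk_center w) (normal_at w y)
  + 2 * r / 3 * ((3 * y + y ^+ 3) / 2).

Lemma add3sqr_gt0 y : 0 < 3 + y ^+ 2. Proof. by rewrite ltr_wpDr ?sqr_ge0. Qed.

Lemma add3sqr_neq0 y : 3 + y ^+ 2 != 0. Proof. by rewrite gt_eqF // add3sqr_gt0. Qed.

Lemma normal_at_unit w y : dot w w = 1 -> dot (normal_at w y) (normal_at w y) = 1.
Proof. move=> w1; rewrite dot_frame //; field; exact: add3sqr_neq0. Qed.

(** Both normals in the sector of the same disk: the corner is a kite. *)
Lemma corner_bound0 w y z : dot w w = 1 -> -1 <= y <= 1 -> -1 <= z <= 1 ->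
  let u := normal_at w y in let v := normal_at w z in let O := disk_center w in
  0 < cross u v -> [/\ y < z, 0 <= leg_num O u O v / cross u v,
    0 <= leg_num O v O u / cross u v &
   potential w z - potential w y - 3 / 4 * r <=
  (leg_num O u O v * (1 + dot O u) + leg_num O v O u * (1 + dot O v)) / cross u v].
Proof.
move=> w1 /andP[y0 y1] /andP[z0 z1] u v O S.
have r0 := sqrt3_gt0.
set P := 3 + y * z; set D := z - y.
have P2 : 2 <= P by rewrite /P; nra.
have Ny := add3sqr_neq0 y; have Nz := add3sqr_neq0 z; have P0 : P != 0 by lra.
have ES : cross u v = r * (2 * D * P / ((3 + y ^+ 2) * (3 + z ^+ 2))).
  rewrite cross_frame // /P /D; field. by rewrite Ny Nz.
have D0 : 0 < D.
  have NN : 0 < (3 + y ^+ 2) * (3 + z ^+ 2) by rewrite mulr_gt0 ?add3sqr_gt0.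
  move: S; rewrite ES pmulr_rgt0 // ltr_pdivlMr // mul0r pmulr_lgt0; last lra.
  by rewrite pmulr_rgt0.
have ET : (1 - dot u v) / cross u v = r * D / P.
  rewrite ES dot_frame //.
  have -> : r * D / P = r ^+ 2 * D / (r * P) by field; rewrite P0 gt_eqF.
  rewrite sqrt3_sqr /P /D; field.
  by rewrite Ny Nz -/P -/D P0 !gt_eqF.
have T0 : 0 <= r * D / P by rewrite divr_ge0 ?mulr_ge0 //; lra.
have L1 : leg_num O u O v = 1 - dot u v by rewrite /leg_num; ring.
have L2 : leg_num O v O u = 1 - dot u v by rewrite /leg_num /dot; ring.
split; first by move: D0; rewrite /D; lra.
- by rewrite L1 ET.
- by rewrite L2 ET.
rewrite corner_identity ?normal_at_unit ?gt_eqF //.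
rewrite ET !subrr !(mul0r, addr0, mulr0).
have -> : cross O O = 0 by rewrite /cross; ring.
rewrite /potential -/u -/v -/O.
have F : 0 <= 24*D+9*P+24*D*P-12*D*P^+2-4*D^+3*P.
  have H : 0 <= (1 + y) * (1 - z) by rewrite mulr_ge0 //; lra.
  apply: corner_poly0_ge0 => //; first by move: D0; rewrite /D; lra.
  by rewrite /P /D; lra.
have : 0 <= (24*D+9*P+24*D*P-12*D*P^+2-4*D^+3*P) / (12 * P) * r.
  by rewrite mulr_ge0 ?divr_ge0 //; lra.
have -> : (24*D+9*P+24*D*P-12*D*P^+2-4*D^+3*P) / (12 * P) * r =
 2 * (r * D / P) - (2 * r / 3 * ((3 * z + z ^+ 3) / 2)) + (2 * r / 3 * ((3 * y
   + y ^+ 3) / 2)) + 3 / 4 * r.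
  rewrite /P /D; field; exact: P0.
lra.
Qed.

Lemma sqrt3_ge : 17 / 10 <= r.
Proof.
have r0 := sqrt3_gt0; have E := sqrt3_sqr; rewrite leNgt; apply/negP => h.
have : r ^+ 2 < (17/10) ^+ 2 by rewrite ltr_pXn2r ?nnegrE //; lra.
by rewrite sqrt3_sqr; lra.
Qed.

Lemma unit_frame w a b : dot w w = 1 -> a ^+ 2 + 3 * b ^+ 2 = 1 ->
  dot (frame w a b) (frame w a b) = 1.
Proof. by move=> w1 ab; rewrite dot_frame // -mulrA -!expr2. Qed.

(** The normals lie in adjacent sectors.  The triangle of [corner_identity] is not
    worth much near the cheapest corners and is estimated by 0. *)
Lemma corner_bound1 w y z : dot w w = 1 -> -1 <= y <= 1 -> -1 <= z <= 1 ->
  let w' := frame w (- 2^-1) (2^-1) in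
  let u := normal_at w y in let v := normal_at w' z in
  let O := disk_center w in let O' := disk_center w' in
  0 < cross u v -> [/\ 0 <= leg_num O u O' v / cross u v,
    0 <= leg_num O' v O u / cross u v &
   potential w' z - potential w y + 4 + 10 / 3 * r - 3 / 4 * r <=
  (leg_num O u O' v * (1 + dot O u) + leg_num O' v O u * (1 + dot O' v)) / cross u v].
Proof.
move=> w1 /andP[y0 y1] /andP[z0 z1] w' u v O O' S.
have r0 := sqrt3_gt0.
have w'1 : dot w' w' = 1 by rewrite unit_frame //; field.
set P := 3 + y * z; set D := z - y.
have P2 : 2 <= P by rewrite /P; nra.
have Ny := add3sqr_neq0 y; have Nz := add3sqr_neq0 z; have P0 : P != 0 by lra.
have NN : 0 < (3 + y ^+ 2) * (3 + z ^+ 2) by rewrite mulr_gt0 ?add3sqr_gt0.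
have PD : 0 <= P + D by rewrite /P /D; nra.
have vE : v = frame w (- ((3 - z ^+ 2 + 6 * z) / (3
  + z ^+ 2)) / 2) ((3 - z ^+ 2 - 2 * z) / (3 + z ^+ 2) / 2).
  by rewrite /v /normal_at frame_frame; congr frame; field; rewrite Nz.
have O'E : O' = frame w (- (r / 3)) (r / 3).
  by rewrite /O' /disk_center frame_frame; congr frame; field.
have ES : cross u v = r * ((P - 3 * D) * (P + D) / (2 * ((3 + y ^+ 2) * (3 + z ^+ 2)))).
  rewrite vE cross_frame // /P /D; field. by rewrite Ny Nz.
have PD3 : 0 < P - 3 * D.
  move: S; rewrite ES pmulr_rgt0 // ltr_pdivlMr ?mulr_gt0 ?add3sqr_gt0 // mul0r; nra.
have PD' : 0 < P + D.
  rewrite lt_neqAle PD andbT eq_sym; apply/eqP => E.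
  by move: S; rewrite ES E mulr0 mul0r mulr0 ltxx.
have ed : 1 - dot u v = 3 / 2 * (P + D) ^+ 2 / ((3 + y ^+ 2) * (3 + z ^+ 2)).
  by rewrite vE dot_frame // /P /D; field; rewrite Ny Nz.
have d0 : 0 <= 1 - dot u v by rewrite ed !mulr_ge0 ?sqr_ge0 ?invr_ge0 ?(ltW NN) //; lra.
have emv : dot O' v - dot O v = r * ((1 + z) * (3 - z) / (3 + z ^+ 2)).
  by rewrite O'E vE !dot_frame //; field; rewrite Nz.
have emu : dot O u - dot O' u = r * ((1 - y) * (3 + y) / (3 + y ^+ 2)).
  by rewrite O'E !dot_frame //; field; rewrite Ny.
have mv0 : 0 <= dot O' v - dot O v.
  by rewrite emv mulr_ge0 ?divr_ge0 ?mulr_ge0 ?(ltW (add3sqr_gt0 _)) //; lra.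
have mu0 : 0 <= dot O u - dot O' u.
  by rewrite emu mulr_ge0 ?divr_ge0 ?mulr_ge0 ?(ltW (add3sqr_gt0 _)) //; lra.
split.
- by rewrite divr_ge0 ?(ltW S) // /leg_num; lra.
- rewrite divr_ge0 ?(ltW S) // /leg_num; move: d0 mu0; rewrite /dot; lra.
rewrite corner_identity ?normal_at_unit ?gt_eqF //.
have -> : cross O O' = 2 / 3 * r.
  have -> : 2 / 3 * r = 2 / 9 * r ^+ 2 * r by rewrite sqrt3_sqr; field.
  by rewrite O'E cross_frame //; field.
have -> : (1 - dot u v) / cross u v = r * (P + D) / (P - 3 * D).
  have -> : r * (P + D) / (P - 3 * D) = r ^+ 2 * (P + D) / (r * (P - 3 * D)) by field;
    rewrite !gt_eqF.
  by rewrite ed ES sqrt3_sqr; field; rewrite Ny Nz !gt_eqF.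
have -> : (dot O u - dot O' u + (dot O' v - dot O v)) / cross u v = 2
  + r ^+ 2 * 2 * (4 - P + D) / (P - 3 * D).
  rewrite emu emv ES sqrt3_sqr /P /D; field.
  by rewrite Ny Nz -/P -/D !gt_eqF.
have mm : 0 <= (dot O u - dot O' u) * (dot O' v - dot O v) / cross u v.
  by rewrite divr_ge0 ?mulr_ge0 // ltW.
have h1 : 0 <= (1 - y) * (1 + z) by rewrite mulr_ge0 //; lra.
have h2 : 0 <= (1 + y) * (1 - z) by rewrite mulr_ge0 //; lra.
have eab : (1 - y) * (1 + z) = 4 - P + D by rewrite /P /D; ring.
have F : 0 <= 3*(P+D) + 51/5*(4-P+D) - (P-3*D)*(D*(D^+2+3*P-6)/2+23/8).
  have [Dge|Dlt] := lerP 0 D.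
    apply: corner_poly1_ge0_pos => //; last by rewrite /P /D; lra.
    by apply/andP; split => //; move: PD3 h2; rewrite /P /D; lra.
  have t2 : 0 <= - D <= 2 by move: Dlt; rewrite /D; lra.
  have lo : 12 <= (- D) ^+ 2 + 4 * P by rewrite /P /D; have := sqr_ge0 (z + y); lra.
  have hi : P + - D <= 4 by move: h1; rewrite eab; lra.
  by have := corner_poly1_ge0_neg t2 lo hi; lra.
have rr := sqrt3_ge.
have F' : 0 <= 3*(P+D) + 6 * r *(4-P+D) - (P-3*D)*(D*(D^+2+3*P-6)/2+23/8).
  have : 0 <= (r - 17/10) * (4 - P + D) by rewrite mulr_ge0 -?eab //; lra.
  lra.
have : 0 <= 2 / 3 * r * ((3*(P+D)
  + 6 * r *(4-P+D) - (P-3*D)*(D*(D^+2+3*P-6)/2+23/8)) / (P - 3 * D)).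
  by apply: mulr_ge0; [lra | apply: divr_ge0 => //; exact: ltW].
have -> : 2 / 3 * r * ((3*(P+D)
  + 6 * r *(4-P+D) - (P-3*D)*(D*(D^+2+3*P-6)/2+23/8)) / (P - 3 * D))
  = 2 * (r * (P + D) / (P - 3 * D)) + 2 * (r ^+ 2 * 2 * (4 - P + D) / (P - 3 * D))
   - (2 * r / 3 * ((3 * z + z ^+ 3) / 2)) + (2 * r / 3 * ((3 * y
     + y ^+ 3) / 2)) - 23 / 12 * r.
  rewrite /P /D; field; by rewrite -/P -/D gt_eqF.
rewrite /potential -/u -/v -/O -/O'; lra.
Qed.

(** A corner around a whole sector, whose disk does not touch either side.  The
    strips and the triangle of [corner_identity] have at least the areas 4 and r
    that they have when both normals are at the borders of that sector; only the
    kite is left to compare with the potential. *)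
Lemma corner_bound2 w y z : dot w w = 1 -> -1 <= y <= 1 -> -1 <= z <= 1 ->
  let w' := frame w (- 2^-1) (- 2^-1) in
  let u := normal_at w y in let v := normal_at w' z in
  let O := disk_center w in let O' := disk_center w' in
  0 < cross u v -> [/\ 0 <= leg_num O u O' v / cross u v,
    0 <= leg_num O' v O u / cross u v &
   potential w' z - potential w y + 8 + 20 / 3 * r - 3 / 4 * r <=
  (leg_num O u O' v * (1 + dot O u) + leg_num O' v O u * (1 + dot O' v)) / cross u v].
Proof.
move=> w1 /andP[y0 y1] /andP[z0 z1] w' u v O O' S.
have r0 := sqrt3_gt0.
have w'1 : dot w' w' = 1 by rewrite unit_frame //; field.
set P := 3 + y * z; set D := z - y.
have P2 : 2 <= P by rewrite /P; nra.
have Ny := add3sqr_neq0 y; have Nz := add3sqr_neq0 z; have P0 : P != 0 by lra.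
have NN : 0 < (3 + y ^+ 2) * (3 + z ^+ 2) by rewrite mulr_gt0 ?add3sqr_gt0.
have PD : 0 <= P - D by rewrite /P /D; nra.
have vE : v = frame w (- ((3 - z ^+ 2 - 6 * z) / (3 + z ^+ 2)) / 2) (- ((3 - z ^+ 2
  + 2 * z) / (3 + z ^+ 2)) / 2).
  by rewrite /v /normal_at frame_frame; congr frame; field; rewrite Nz.
have O'E : O' = frame w (- (r / 3)) (- (r / 3)).
  by rewrite /O' /disk_center frame_frame; congr frame; field.
set E := - P - 3 * D.
have ES : cross u v = r * (E * (P - D) / (2 * ((3 + y ^+ 2) * (3 + z ^+ 2)))).
  rewrite vE cross_frame // /E /P /D; field. by rewrite Ny Nz.
have E0 : 0 < E.
  move: S; rewrite ES pmulr_rgt0 // ltr_pdivlMr ?mulr_gt0 ?add3sqr_gt0 // mul0r; nra.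
have PD' : 0 < P - D.
  rewrite lt_neqAle PD andbT eq_sym; apply/eqP => Z.
  by move: S; rewrite ES Z mulr0 mul0r mulr0 ltxx.
have ed : 1 - dot u v = 3 / 2 * (P - D) ^+ 2 / ((3 + y ^+ 2) * (3 + z ^+ 2)).
  by rewrite vE dot_frame // /P /D; field; rewrite Ny Nz.
have d0 : 0 <= 1 - dot u v by rewrite ed !mulr_ge0 ?sqr_ge0 ?invr_ge0 ?(ltW NN) //; lra.
have emv : dot O' v - dot O v = r * ((1 - z) * (3 + z) / (3 + z ^+ 2)).
  by rewrite O'E vE !dot_frame //; field; rewrite Nz.
have emu : dot O u - dot O' u = r * ((1 + y) * (3 - y) / (3 + y ^+ 2)).
  by rewrite O'E !dot_frame //; field; rewrite Ny.
have mv0 : 0 <= dot O' v - dot O v.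
  by rewrite emv mulr_ge0 ?divr_ge0 ?mulr_ge0 ?(ltW (add3sqr_gt0 _)) //; lra.
have mu0 : 0 <= dot O u - dot O' u.
  by rewrite emu mulr_ge0 ?divr_ge0 ?mulr_ge0 ?(ltW (add3sqr_gt0 _)) //; lra.
split.
- by rewrite divr_ge0 ?(ltW S) // /leg_num; lra.
- rewrite divr_ge0 ?(ltW S) // /leg_num; move: d0 mu0; rewrite /dot; lra.
rewrite corner_identity ?normal_at_unit ?gt_eqF //.
have -> : cross O O' = - (2 / 3 * r).
  have -> : 2 / 3 * r = 2 / 9 * r ^+ 2 * r by rewrite sqrt3_sqr; field.
  by rewrite O'E cross_frame //; field.
have -> : (1 - dot u v) / cross u v = r * (P - D) / E.
  have -> : r * (P - D) / E = r ^+ 2 * (P - D) / (r * E) by field; rewrite !gt_eqF.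
  by rewrite ed ES sqrt3_sqr; field; rewrite Ny Nz !gt_eqF.
have h1 : 0 <= (1 - y) * (1 + z) by rewrite mulr_ge0 //; lra.
have h2 : 0 <= (1 + y) * (1 - z) by rewrite mulr_ge0 //; lra.
have eab : (1 + y) * (1 - z) = 4 - P - D by rewrite /P /D; ring.
have M1 : 4 <= (dot O u - dot O' u + (dot O' v - dot O v)) / cross u v.
  have -> : (dot O u - dot O' u + (dot O' v - dot O v)) / cross u v = 4
    + 6 * (4 - P - D - E) / E.
    rewrite emu emv ES /E /P /D; field.
    by rewrite Ny Nz -/P -/D -/E !gt_eqF.
  by rewrite lerDl divr_ge0 ?(ltW E0) // mulr_ge0 // /E /D; lra.
have M2 : 2 * r <= (dot O u - dot O' u) * (dot O' v - dot O v) / cross u v.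
  have -> : (dot O u - dot O' u) * (dot O' v - dot O v) / cross u v =
    2 * r * (((1 + y) * (1 - z)) * ((3 - y) * (3 + z)) / (E * (P - D))).
    rewrite emu emv ES; field.
    by rewrite Ny Nz !gt_eqF.
  rewrite ler_peMr //; first lra.
  rewrite ler_pdivlMr ?mulr_gt0 // mul1r ler_pM ?(ltW E0) ?(ltW PD') //.
    by rewrite eab /E /D; lra.
  by rewrite /P /D; lra.
have F : 0 <= 3*(P-D) - E*(D*(D^+2+3*P-6)/2+55/8).
  have t2 : 0 <= - D <= 2 by move: E0; rewrite /E; rewrite /D; lra.
  have lo : 12 <= (- D) ^+ 2 + 4 * P by rewrite /P /D; have := sqr_ge0 (z + y); lra.
  have hi : P + - D <= 4 by move: h1; rewrite /P /D; lra.
  by have := corner_poly2_ge0 t2 lo hi; rewrite /E; lra.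
have : 0 <= 2 / 3 * r * ((3*(P-D) - E*(D*(D^+2+3*P-6)/2+55/8)) / E).
  by apply: mulr_ge0; [lra | apply: divr_ge0 => //; exact: ltW].
have -> : 2 / 3 * r * ((3*(P-D) - E*(D*(D^+2+3*P-6)/2+55/8)) / E)
  = 2 * (r * (P - D) / E)
   - (2 * r / 3 * ((3 * z + z ^+ 3) / 2)) + (2 * r / 3 * ((3 * y
     + y ^+ 3) / 2)) - 55 / 12 * r.
  rewrite /E /P /D; field; by rewrite -/P -/D -/E gt_eqF.
rewrite /potential -/u -/v -/O -/O'; lra.
Qed.

End Vec.

(** * Area of convex quadrilaterals *)

Section Area.
Variable R : realType.
Notation mu := (@lebesgue_measure R).

Definition leftof (A B : R * R) : set (R * R) := [set P | 0 <= turn A B P].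
Definition halfplanes (A B C D : R * R) : set (R * R) :=
  leftof A B `&` leftof B C `&` (leftof C D `&` leftof D A).
Definition ccw (A B C D : R * R) : Prop :=
  [/\ 0 < turn A B C, 0 < turn B C D, 0 < turn C D A & 0 < turn D A B].

Lemma triangle_weights (A B C P : R * R) : 0 < turn A B C ->
  0 <= turn A B P -> 0 <= turn B C P -> 0 <= turn C A P ->
  exists a b c : R, [/\ 0 <= a, 0 <= b & 0 <= c] /\ a + b + c = 1 /\
   P = (a * A.1 + b * B.1 + c * C.1, a * A.2 + b * B.2 + c * C.2).
Proof.
move=> T h1 h2 h3; have T0 : turn A B C != 0 by rewrite gt_eqF.
exists (turn B C P / turn A B C), (turn C A P / turn A B C), (turn A B P / turn A B C).
split; first by rewrite !divr_ge0 // ltW.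
case: A B C P T0 {T h1 h2 h3} => A1 A2 [B1 B2] [C1 C2] [P1 P2]; rewrite /turn /= => T0.
split; first by field.
by congr pair; field.
Qed.

(** A point of the intersection of the half-planes lies in one of the two triangles cut
    off by the diagonal AC, where its barycentric coordinates are ratios of signed
    areas. *)
Lemma quad_halfplanes (A B C D : R * R) : ccw A B C D -> quad A B C D = halfplanes A B C D.
Proof.
move=> [t1 t2 t3 t4]; apply/seteqP; split => [P|P].
  move=> [a [b [c [d [[a0 b0 c0 d0] [s ->]]]]]].
  have E : a = 1 - b - c - d by lra.
  rewrite /halfplanes /leftof /=; split; split.
  - have -> : turn A B (a * A.1 + b * B.1 + c * C.1 + d * D.1,
    a * A.2 + b * B.2 + c * C.2 + d * D.2) = c * turn A B C + d * turn D A B.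
      by rewrite /turn /= E; ring.
    by rewrite addr_ge0 // mulr_ge0 // ltW.
  - have -> : turn B C (a * A.1 + b * B.1 + c * C.1 + d * D.1,
    a * A.2 + b * B.2 + c * C.2 + d * D.2) = d * turn B C D + a * turn A B C.
      by rewrite /turn /= E; ring.
    by rewrite addr_ge0 // mulr_ge0 // ltW.
  - have -> : turn C D (a * A.1 + b * B.1 + c * C.1 + d * D.1,
    a * A.2 + b * B.2 + c * C.2 + d * D.2) = a * turn C D A + b * turn B C D.
      by rewrite /turn /= E; ring.
    by rewrite addr_ge0 // mulr_ge0 // ltW.
  - have -> : turn D A (a * A.1 + b * B.1 + c * C.1 + d * D.1,
    a * A.2 + b * B.2 + c * C.2 + d * D.2) = b * turn D A B + c * turn C D A.
      by rewrite /turn /= E; ring.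
    by rewrite addr_ge0 // mulr_ge0 // ltW.
move=> [[/= h1 h2] [/= h3 h4]].
have E : turn C A P = - turn A C P by rewrite /turn; ring.
have [h|h] := lerP 0 (turn C A P).
  have [a [b [c [[a0 b0 c0] [s ->]]]]] := triangle_weights t1 h1 h2 h.
  exists a, b, c, 0; split; first by [].
  split; first by rewrite addr0.
  by rewrite !mul0r !addr0.
have h' : 0 <= turn A C P by rewrite E in h; lra.
have t3' : 0 < turn A C D by move: t3; rewrite /turn; lra.
have [a [c [d [[a0 c0 d0] [s ->]]]]] := triangle_weights t3' h' h3 h4.
exists a, 0, c, d; split; first by [].
split; first by rewrite addr0.
by rewrite !mul0r !addr0.
Qed.

Lemma measurable_leftof A B : measurable (leftof A B).
Proof.
have -> : leftof A B = (fun P => turn A B P) @^-1` `[0, +oo[%classic.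
  by apply/seteqP; split => P; rewrite /leftof /= in_itv /= andbT.
rewrite -[X in measurable X]setTI.
apply: (_ : measurable_fun setT (fun P : R * R => turn A B P)) => //.
apply: measurable_funB; apply: measurable_funM => //; apply: measurable_funB => //.
Qed.

Lemma measurable_halfplanes A B C D : measurable (halfplanes A B C D).
Proof. by apply: measurableI; apply: measurableI; exact: measurable_leftof. Qed.

(** Both sides are measures in X that agree on half-open intervals. *)
Lemma lebesgue_shift (c : R) (X : set R) : measurable X ->
  mu ((fun y => y + c) @^-1` X) = mu X.
Proof.
move=> mX.
pose f : measurableTypeR R -> measurableTypeR R := fun y => y + c.
have mf : measurable_fun [set: measurableTypeR R] f by apply: measurable_funD.
rewrite [RHS](@lebesgue_measure_unique R (pushforward mu f)) //.
move=> _ [[a b] _ <-] /=; rewrite /pushforward /f.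
have -> : (fun y : R => y + c) @^-1` `]a, b] = `]a - c, b - c]%classic.
  by apply/seteqP; split => y; rewrite /= !in_itv /= ltrBlDr lerBrDr.
rewrite !lebesgue_measure_itv /= !lte_fin ltrD2r; case: ifP => // _.
by rewrite -!EFinB; congr EFin; ring.
Qed.

Definition vshear k (P : R * R) := (P.1, P.2 + k * P.1).
Definition hshear k (P : R * R) := (P.1 + k * P.2, P.2).

Lemma area_vshear k X : measurable X -> area (vshear k @^-1` X) = area X.
Proof.
move=> mX; apply: eq_integral => x _ /=.
have mXx : measurable (xsection X x : set R) by exact: measurable_xsection.
rewrite -(lebesgue_shift (k * x) mXx).
by congr (mu _); apply/seteqP; split => y /=; rewrite /xsection /= !inE.
Qed.

(** The area is defined through vertical sections; horizontal shears move the
    horizontal ones. *)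
Lemma area_ysection (X : set (R * R)) : measurable X -> area X = (mu \x^ mu)%E X.
Proof.
move=> mX; apply: product_measure_unique => //= B C mB mC; exact: product_measure2E.
Qed.

Lemma area_hshear k X : measurable X -> measurable (hshear k @^-1` X) ->
  area (hshear k @^-1` X) = area X.
Proof.
move=> mX mY; rewrite !area_ysection //; apply: eq_integral => y _ /=.
have mXy : measurable (ysection X y : set R) by exact: measurable_ysection.
rewrite -(lebesgue_shift (k * y) mXy).
by congr (mu _); apply/seteqP; split => x /=; rewrite /ysection /= !inE.
Qed.

Lemma halfplanes_vshear k A B C D : vshear k @^-1` halfplanes A B C D =
  halfplanes (vshear (- k) A) (vshear (- k) B) (vshear (- k) C) (vshear (- k) D).
Proof.
have E X Y P : turn X Y (vshear k P) = turn (vshear (- k) X) (vshear (- k) Y) P.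
  rewrite /turn /vshear /=; ring.
by apply/seteqP; split => P; rewrite /halfplanes /leftof /= !E.
Qed.

Lemma halfplanes_hshear k A B C D : hshear k @^-1` halfplanes A B C D =
  halfplanes (hshear (- k) A) (hshear (- k) B) (hshear (- k) C) (hshear (- k) D).
Proof.
have E X Y P : turn X Y (hshear k P) = turn (hshear (- k) X) (hshear (- k) Y) P.
  rewrite /turn /hshear /=; ring.
by apply/seteqP; split => P; rewrite /halfplanes /leftof /= !E.
Qed.

Lemma integral_affine (a b m c : R) : a < b ->
  (\int[mu]_(x in `[a, b]) (m * x + c)%:E = ((b - a) * (m * (a + b) / 2 + c))%:E)%E.
Proof.
move=> ab.
pose F x := m / 2 * x ^+ 2 + c * x.
have dF (x : R) : is_derive x (1 : R) F (m * x + c).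
  by apply: is_derive_eq; rewrite /GRing.scale /=; field.
transitivity ((F b)%:E - (F a)%:E)%E; last by rewrite -EFinB /F; congr EFin; field.
apply: (@continuous_FTC2 _ (fun x => m * x + c) F) => //.
- apply: continuous_subspaceT => x; apply: cvgD; last exact: cvg_cst.
  by apply: cvgM; [exact: cvg_cst|exact: cvg_id].
- have cF : continuous F by move=> x; apply: differentiable_continuous;
  apply/derivable1_diffP; apply: ex_derive.
  split; first by move=> x _; apply: ex_derive.
  + exact: cvg_at_right_filter (cF a).
  + exact: cvg_at_left_filter (cF b).
- by move=> x _; rewrite derive1E derive_val.
Qed.

(** To the right of the vertical diagonal the two sides on the left impose no
    constraint: by convexity their half-planes contain the triangle on the
    right. *)
Lemma section_right (a p q b be d de x y : R) : p < q ->
  ccw (a, p) (b, be) (a, q) (d, de) -> a <= x ->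
  halfplanes (a, p) (b, be) (a, q) (d, de) (x, y) <->
  x <= b /\ p + (be - p) * (x - a) / (b - a) <= y <= q + (be - q) * (x - a) / (b - a).
Proof.
move=> pq [t1 t2 t3 t4] ax; rewrite /halfplanes /leftof /=.
have ab : 0 < b - a by move: t1; rewrite /turn /=; nra.
have da : 0 < a - d by move: t3; rewrite /turn /=; nra.
have e1 : turn (a, p) (b, be) (x, y) = (b - a) * (y - (p + (be - p) * (x - a) / (b - a))).
  by rewrite /turn /=; field; rewrite gt_eqF.
have e2 : turn (b, be) (a, q) (x, y) = (b - a) * (q + (be - q) * (x - a) / (b - a) - y).
  by rewrite /turn /=; field; rewrite gt_eqF.
split.
  move=> [[h1 h2] _]; split.
    have : 0 <= (q - p) * (b - x).
      have -> : (q - p) * (b - x) = turn (a, p) (b, be) (x, y) + turn (b, be) (a, q) (x, y).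
        by rewrite /turn /=; ring.
      exact: addr_ge0.
    by rewrite pmulr_rge0 ?subr_gt0 // subr_ge0.
  move: h1 h2; rewrite e1 e2 !pmulr_rge0 // !subr_ge0 => -> ->; by [].
move=> [xb /andP[h1 h2]].
have h1' : 0 <= turn (a, p) (b, be) (x, y) by rewrite e1 pmulr_rge0 // subr_ge0.
have h2' : 0 <= turn (b, be) (a, q) (x, y) by rewrite e2 pmulr_rge0 // subr_ge0.
have xa0 : 0 <= x - a by rewrite subr_ge0.
split; split => //.
  rewrite -(pmulr_rge0 _ ab).
  have -> : (b - a) * turn (a, q) (d, de) (x, y) =
    (a - d) * turn (b, be) (a, q) (x, y) + (x - a) * turn (b, be) (a, q) (d, de).
    by rewrite /turn /=; ring.
  by apply: addr_ge0; apply: mulr_ge0 => //; exact: ltW.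
rewrite -(pmulr_rge0 _ ab).
have -> : (b - a) * turn (d, de) (a, p) (x, y) =
  (a - d) * turn (a, p) (b, be) (x, y) + (x - a) * turn (d, de) (a, p) (b, be).
  by rewrite /turn /=; ring.
by apply: addr_ge0; apply: mulr_ge0 => //; exact: ltW.
Qed.

(** The reflection in the origin exchanges the two triangles. *)
Lemma section_left (a p q b be d de x y : R) : p < q ->
  ccw (a, p) (b, be) (a, q) (d, de) -> x <= a ->
  halfplanes (a, p) (b, be) (a, q) (d, de) (x, y) <->
  d <= x /\ p + (de - p) * (a - x) / (a - d) <= y <= q + (de - q) * (a - x) / (a - d).
Proof.
move=> pq [t1 t2 t3 t4] xa.
have qp : - q < - p by rewrite ltrN2.
have F (x1 x2 y1 y2 x3 y3 : R) : turn (- x1, - x2) (- y1, - y2) (- x3,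
  - y3) = turn (x1, x2) (y1, y2) (x3, y3).
  by rewrite /turn /=; ring.
have cc : ccw (- a, - q) (- d, - de) (- a, - p) (- b, - be).
  by split; rewrite F.
have ax : - a <= - x by rewrite lerN2.
have := section_right (- y) qp cc ax.
have -> : halfplanes (- a, - q) (- d, - de) (- a, - p) (- b, - be) (- x, - y) <->
   halfplanes (a, p) (b, be) (a, q) (d, de) (x, y).
  rewrite /halfplanes /leftof /= !F.
  by split => -[[? ?] [? ?]].
move=> ->; rewrite lerN2.
have -> : - q + (- de - - q) * (- x - - a) / (- d - - a) = - (q
  + (de - q) * (a - x) / (a - d)).
  by rewrite !opprK [- x + a]addrC [- d + a]addrC; ring.
have -> : - p + (- de - - p) * (- x - - a) / (- d - - a) = - (p
  + (de - p) * (a - x) / (a - d)).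
  by rewrite !opprK [- x + a]addrC [- d + a]addrC; ring.
by rewrite !lerN2 [(_ <= y) && _]andbC.
Qed.

Lemma lebesgue_segment (a b : R) : a <= b -> mu `[a, b]%classic = (b - a)%:E.
Proof.
rewrite lebesgue_measure_itv /= lte_fin le_eqVlt => /predU1P[->|->] //.
by rewrite ltxx subrr.
Qed.

Lemma area_vertical (a p q b be d de : R) : p < q ->
  ccw (a, p) (b, be) (a, q) (d, de) ->
  area (halfplanes (a, p) (b, be) (a, q) (d, de)) = ((q - p) * (b - d) / 2)%:E.
Proof.
move=> pq cc; have [t1 t2 t3 t4] := cc.
have ab : 0 < b - a by move: t1; rewrite /turn /=; nra.
have da : 0 < a - d by move: t3; rewrite /turn /=; nra.
have ab' : a < b by rewrite -subr_gt0.
have da' : d < a by rewrite -subr_gt0.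
set H := halfplanes _ _ _ _.
pose f1 (x : R) := (- ((q - p) / (b - a)) * x + (q - p) * b / (b - a))%:E.
pose f2 (x : R) := (((q - p) / (a - d)) * x + - ((q - p) * d / (a - d)))%:E.
have E1 x : f1 x = ((q - p) * (b - x) / (b - a))%:E.
  by rewrite /f1; congr EFin; field; rewrite gt_eqF.
have E2 x : f2 x = ((q - p) * (x - d) / (a - d))%:E.
  by rewrite /f2; congr EFin; field; rewrite gt_eqF.
have f10 x : x \in `[a, b] -> (0 <= f1 x)%E.
  by rewrite in_itv /= => /andP[? ?];
    rewrite E1 lee_fin divr_ge0 ?mulr_ge0 ?subr_ge0 // ltW.
have f20 x : x \in `[d, a[ -> (0 <= f2 x)%E.
  by rewrite in_itv /= => /andP[? ?];
    rewrite E2 lee_fin divr_ge0 ?mulr_ge0 ?subr_ge0 // ltW.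
have secE x : mu (xsection H x) = ((f1 \_ `[a, b]) x + (f2 \_ `[d, a[) x)%E.
  rewrite /patch !mem_setE !in_itv /=.
  have [ax|xa] := leP a x.
    rewrite andbF /= [X in (_ + X)%E](_ : _ = 0%E) // adde0.
    have [xb|bx] := leP x b => /=.
      have -> : xsection H x = `[p + (be - p) * (x - a) / (b - a),
        q + (be - q) * (x - a) / (b - a)]%classic.
        apply/seteqP; split => y; rewrite /xsection /= inE in_itv /=.
          by move=> /(section_right y pq cc ax)[].
        by move=> h; apply/(section_right y pq cc ax).
      have len : q + (be - q) * (x - a) / (b - a) - (p
        + (be - p) * (x - a) / (b - a)) = (q - p) * (b - x) / (b - a).
        by field; rewrite gt_eqF.
      rewrite E1 lebesgue_segment ?len //.
      by rewrite -subr_ge0 len divr_ge0 ?mulr_ge0 ?subr_ge0 // ltW.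
    have -> : xsection H x = set0.
      apply/seteqP; split => y //; rewrite /xsection /= inE.
      by move=> /(section_right y pq cc ax)[]; rewrite leNgt bx.
    by rewrite measure0.
  have xa' := ltW xa.
  rewrite andbT /= [X in (X + _)%E](_ : _ = 0%E) // add0e.
  have [dx|xd] := leP d x => /=.
    have -> : xsection H x = `[p + (de - p) * (a - x) / (a - d),
      q + (de - q) * (a - x) / (a - d)]%classic.
      apply/seteqP; split => y; rewrite /xsection /= inE in_itv /=.
        by move=> /(section_left y pq cc xa')[].
      by move=> h; apply/(section_left y pq cc xa').
    have len : q + (de - q) * (a - x) / (a - d) - (p
      + (de - p) * (a - x) / (a - d)) = (q - p) * (x - d) / (a - d).
      by field; rewrite gt_eqF.
    rewrite E2 lebesgue_segment ?len //.
    by rewrite -subr_ge0 len divr_ge0 ?mulr_ge0 ?subr_ge0 // ltW.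
  have -> : xsection H x = set0.
    apply/seteqP; split => y //; rewrite /xsection /= inE.
    by move=> /(section_left y pq cc xa')[]; rewrite leNgt xd.
  by rewrite measure0.
have mf (m c : R) D : measurable_fun D (fun x : R => (m * x + c)%:E).
  apply/measurable_EFinP; apply: measurable_funD => //; apply: measurable_funM => //.
transitivity (\int[mu]_x ((f1 \_ `[a, b]) x + (f2 \_ `[d, a[) x))%E.
  by apply: eq_integral => x _; exact: secE.
rewrite ge0_integralD //=; first last.
- by apply/(measurable_restrictT _ _).1 => //; exact: mf.
- by move=> x _; apply: erestrict_ge0 => y /=; exact: f20.
- by apply/(measurable_restrictT _ _).1 => //; exact: mf.
- by move=> x _; apply: erestrict_ge0 => y /=; exact: f10.
rewrite -!integral_mkcond integral_itv_bndo_bndc; last exact: mf.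
rewrite !integral_affine // -EFinD; congr EFin; field.
by rewrite !gt_eqF.
Qed.

Lemma halfplanes_rot (A B C D : R * R) : halfplanes C D A B = halfplanes A B C D.
Proof. by apply/seteqP; split => P [[? ?] [? ?]]. Qed.

(** When A lies above C, the same quadrilateral is named from its opposite
    vertex. *)
Lemma area_halfplanes_vertical (A B C D : R * R) : ccw A B C D -> A.1 = C.1 ->
  area (halfplanes A B C D) = ((turn A B C + turn C D A) / 2)%:E.
Proof.
move: A B C D => [a p] [b be] [c q] [d de] cc /= ac; rewrite -{}ac in cc *.
have [t1 t2 t3 t4] := cc.
have [pq|qp|pq] := ltgtP p q.
- by rewrite area_vertical //; congr EFin; rewrite /turn /=; ring.
- rewrite -halfplanes_rot area_vertical //.
  by congr EFin; rewrite /turn /=; ring.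
- by exfalso; move: t1; rewrite pq /turn /=; lra.
Qed.

Lemma turn_hshear (k : R) A B C : turn (hshear k A) (hshear k B) (hshear k C) = turn A B C.
Proof. rewrite /turn /hshear /=; ring. Qed.

Lemma turn_vshear (k : R) A B C : turn (vshear k A) (vshear k B) (vshear k C) = turn A B C.
Proof. rewrite /turn /vshear /=; ring. Qed.

Lemma area_halfplanes_slanted (A B C D : R * R) : ccw A B C D -> A.2 != C.2 ->
  area (halfplanes A B C D) = ((turn A B C + turn C D A) / 2)%:E.
Proof.
move=> cc ac; pose k := (C.1 - A.1) / (C.2 - A.2).
have ac' : C.2 - A.2 != 0 by rewrite subr_eq0 eq_sym.
have mH := measurable_halfplanes.
rewrite -(@area_hshear k) ?halfplanes_hshear //.
rewrite area_halfplanes_vertical ?turn_hshear //.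
  by case: cc => *; split; rewrite turn_hshear.
by rewrite /hshear /k /=; field.
Qed.

(** A unit vertical shear reduces a horizontal diagonal to the slanted case. *)
Lemma area_halfplanes (A B C D : R * R) : ccw A B C D ->
  area (halfplanes A B C D) = ((turn A B C + turn C D A) / 2)%:E.
Proof.
move=> cc; have [ac|ac] := eqVneq A.2 C.2; last exact: area_halfplanes_slanted.
have mH := measurable_halfplanes.
rewrite -(@area_vshear 1) // halfplanes_vshear.
rewrite area_halfplanes_slanted ?turn_vshear //.
  by case: cc => *; split; rewrite turn_vshear.
rewrite /vshear /= ac !mulN1r (inj_eq (addrI _)) eqr_opp.
by apply/eqP => ac1; case: cc => t1 _ _ _; move: t1; rewrite /turn ac ac1; lra.
Qed.

Lemma area_quad (A B C D : R * R) : ccw A B C D ->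
  area (quad A B C D) = ((turn A B C + turn C D A) / 2)%:E.
Proof. by move=> cc; rewrite quad_halfplanes // area_halfplanes. Qed.

Lemma quad_rev (A B C D : R * R) : quad D C B A = quad A B C D.
Proof.
apply/seteqP; split => P [a [b [c [d [[a0 b0 c0 d0] [s ->]]]]]]; exists d, c, b, a;
  (split; first by []); (split; [lra | congr pair; ring]).
Qed.

Lemma convex_ccw (A B C D : R * R) : convex_quadrilateral A B C D ->
  ccw A B C D \/ ccw D C B A.
Proof.
case=> [?|[t1 t2 t3 t4]]; [by left|right].
by split; move: t1 t2 t3 t4; rewrite /turn; lra.
Qed.

Lemma eucl_distE (A B : R * R) (d : R) : 0 <= d -> eucl_dist A B = d ->
  (A.1 - B.1) ^+ 2 + (A.2 - B.2) ^+ 2 = d ^+ 2.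
Proof.
by move=> d0 <-; rewrite sqr_sqrtr // addr_ge0 // sqr_ge0.
Qed.

Lemma area_rectangle (A B C D : R * R) (h l : R) : 0 < h -> 0 < l ->
  rectangle h l A B C D ->
  area (quad A B C D) = (h * l)%:E.
Proof.
move=> h0 l0 [DE ortho /(eucl_distE (ltW h0)) AB /(eucl_distE (ltW l0)) BC].
have hl0 : 0 < h * l by rewrite mulr_gt0.
have T2 : turn A B C ^+ 2 = (h * l) ^+ 2.
  rewrite exprMn -AB -BC.
  transitivity (turn A B C ^+ 2 + ((B.1 - A.1) * (C.1 - B.1)
    + (B.2 - A.2) * (C.2 - B.2)) ^+ 2).
    by rewrite ortho expr0n addr0.
  by rewrite /turn; ring.
have E2 : turn B C D = turn A B C by rewrite DE /turn /=; ring.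
have E3 : turn C D A = turn A B C by rewrite DE /turn /=; ring.
have E4 : turn D A B = turn A B C by rewrite DE /turn /=; ring.
move/eqP: T2; rewrite eqf_sqr => /orP[/eqP T|/eqP T].
  rewrite area_quad; last by split; rewrite ?E2 ?E3 ?E4 T.
  by rewrite E3 T; congr EFin; field.
have rev X Y Z : turn Z Y X = - turn X Y Z :> R by rewrite /turn; ring.
rewrite -quad_rev area_quad; last by split; rewrite rev ?E2 ?E3 ?E4 T opprK.
by rewrite (rev B C D) (rev D A B) E2 E4 T; congr EFin; field.
Qed.

End Area.

(** * The packed disks and the sectors *)

Section Main.
Variable R : realType.
Implicit Types (u v w A B O : R * R).
Let r : R := Num.sqrt 3.
Let r2 : r ^+ 2 = 3. Proof. exact: sqrt3_sqr. Qed.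
Let r0 : 0 < r. Proof. exact: sqrt3_gt0. Qed.

Definition turn120 w := frame w (- 2^-1) (2^-1).
(** [axis w 0], [axis w 1] and [axis w 2] point from the centroid of the centres
    to the centres. *)
Definition axis w j := iter j turn120 w.

Lemma frame10 w : frame w 1 0 = w.
Proof. by case: w => a b; rewrite /frame /=; congr pair; ring. Qed.

Lemma turn120_twice w : turn120 (turn120 w) = frame w (- 2^-1) (- 2^-1).
Proof. by rewrite /turn120 frame_frame; congr frame; field. Qed.

Lemma turn120_thrice w : turn120 (turn120 (turn120 w)) = w.
Proof. by rewrite turn120_twice /turn120 frame_frame -[RHS]frame10; congr frame; field. Qed.

Lemma axis_unit w j : dot w w = 1 -> dot (axis w j) (axis w j) = 1.
Proof. by move=> w1; elim: j => //= j IH; rewrite /turn120 unit_frame //; field. Qed.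

Lemma normal_at_near w u : dot w w = 1 -> dot u u = 1 -> 2^-1 <= dot w u ->
  exists y, -1 <= y <= 1 /\ u = normal_at w y.
Proof.
move=> w1 u1; set c := dot w u => ch; pose s := cross w u.
have cs : c ^+ 2 + s ^+ 2 = 1.
  transitivity (dot w w * dot u u); last by rewrite w1 u1 mulr1.
  by rewrite /c /s /dot /cross; ring.
have c1 : 1 + c != 0 by rewrite gt_eqF //; lra.
have uE : u = (c * w.1 - s * w.2, c * w.2 + s * w.1).
  rewrite [LHS]surjective_pairing -[u.1]mul1r -[u.2]mul1r -w1.
  by congr pair; rewrite /c /s /dot /cross; ring.
have s2 : s ^+ 2 = (1 - c) * (1 + c) by lra.
have y2 : (r * s / (1 + c)) ^+ 2 = 3 * (1 - c) / (1 + c).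
  by rewrite !exprMn r2 s2; field.
exists (r * s / (1 + c)); split.
  rewrite -ler_norml -[leRHS](@normr1 R) -ler_sqr ?nnegrE // !real_normK ?num_real // y2.
  by rewrite expr1n ler_pdivrMr; lra.
rewrite [LHS]uE /normal_at y2 /frame -/r.
have -> : (3 - 3 * (1 - c) / (1 + c)) / (3 + 3 * (1 - c) / (1 + c)) = c.
  by field; rewrite c1 gt_eqF //; lra.
have -> : 2 * (r * s / (1 + c)) / (3 + 3 * (1 - c) / (1 + c)) * r = s.
  transitivity (r ^+ 2 * s / 3); last by rewrite r2; field.
  by field; rewrite c1 gt_eqF //; lra.
by [].
Qed.

(** The three sectors cover the circle. *)
Lemma normal_at_exists w u : dot w w = 1 -> dot u u = 1 ->
  exists j y, [/\ (j < 3)%N, -1 <= y <= 1 & u = normal_at (axis w j) y].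
Proof.
move=> w1 u1.
suff [j j3 cj] : exists2 j, (j < 3)%N & 2^-1 <= dot (axis w j) u.
  have [y [y1 uE]] := normal_at_near (axis_unit j w1) u1 cj.
  by exists j, y.
have cs : dot w u ^+ 2 + cross w u ^+ 2 = 1.
  transitivity (dot w w * dot u u); last by rewrite w1 u1 mulr1.
  by rewrite /dot /cross; ring.
have e1 : dot (axis w 1) u = - dot w u / 2 + r / 2 * cross w u.
  by rewrite /axis /= /turn120 /frame /dot /cross /= -/r; field.
have e2 : dot (axis w 2) u = - dot w u / 2 - r / 2 * cross w u.
  by rewrite /axis /= turn120_twice /frame /dot /cross /= -/r; field.
have [ch|ch] := lerP 2^-1 (dot w u); first by exists 0%N.
set c := dot w u in cs e1 e2 ch *; set s := cross w u in cs e1 e2 *.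
have key t : 0 <= t -> t ^+ 2 = s ^+ 2 -> 1 + c <= r * t.
  move=> t0 ts; have [h|h] := lerP (1 + c) 0; first by apply: le_trans h _;
    rewrite mulr_ge0 // ltW.
  have rt : 0 <= r * t by rewrite mulr_ge0 // ltW.
  rewrite -ler_sqr ?nnegrE //; last exact: ltW.
  rewrite exprMn r2 ts; nra.
have [s0|s0] := lerP 0 s.
  by exists 1%N => //; rewrite e1; have := key s s0 erefl; lra.
exists 2%N => //; rewrite e2.
have ns0 : 0 <= - s by lra.
have := key (- s) ns0 (sqrrN s); lra.
Qed.

(** The distances determine the triangle up to its orientation, which is made
    positive by exchanging two disks; this is why the conclusion speaks of an
    arbitrary property Z of the unordered triple. *)
Lemma packed_centroid_frame (O1 O2 O3 : R * R) : efficiently_packed O1 O2 O3 ->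
  exists g w, dot w w = 1 /\
   forall Z : R * R -> Prop, Z O1 -> Z O2 -> Z O3 ->
   forall j, (j < 3)%N ->
     Z (g.1 + (disk_center (axis w j)).1, g.2 + (disk_center (axis w j)).2).
Proof.
have two0 : 0 <= 2 :> R by [].
suff H A B C : eucl_dist A B = 2 -> eucl_dist B C = 2 -> eucl_dist C A = 2 ->
  0 < turn A B C ->
  exists g w, dot w w = 1 /\
   forall Z : R * R -> Prop, Z A -> Z B -> Z C ->
   forall j, (j < 3)%N ->
     Z (g.1 + (disk_center (axis w j)).1, g.2 + (disk_center (axis w j)).2).
  have sym A B : eucl_dist A B = eucl_dist B A :> R.
    by rewrite /eucl_dist; congr Num.sqrt; ring.
  move=> [d1 d2 d3].
  have [t|t|t] := ltgtP 0 (turn O1 O2 O3).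
  - exact: H.
  - have [] := H O1 O3 O2; rewrite 1?sym //; first by move: t; rewrite /turn; lra.
    by move=> g [w [w1 HZ]]; exists g, w; split => // Z Z1 Z2 Z3; exact: HZ.
  - exfalso.
    have E1 := eucl_distE two0 d1; have E2 := eucl_distE two0 d2;
      have E3 := eucl_distE two0 d3.
    move: t E1 E2 E3; rewrite /turn => t E1 E2 E3; nra.
move=> /(eucl_distE two0) E1 /(eucl_distE two0) E2 /(eucl_distE two0) E3 T.
pose d : R * R := (B.1 - A.1, B.2 - A.2).
have T2 : turn A B C ^+ 2 = (2 * r) ^+ 2.
  have e3 : (B.1 - A.1) * (C.1 - B.1) + (B.2 - A.2) * (C.2 - B.2) = - 2 by lra.
  have : turn A B C ^+ 2 + ((B.1 - A.1) * (C.1 - B.1) + (B.2 - A.2) * (C.2 - B.2)) ^+ 2 =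
    ((A.1 - B.1) ^+ 2 + (A.2 - B.2) ^+ 2) * ((B.1 - C.1) ^+ 2
      + (B.2 - C.2) ^+ 2) by rewrite /turn; ring.
  by rewrite e3 E1 E2 exprMn r2; lra.
have TE : turn A B C = 2 * r.
  by move/eqP: T2; rewrite eqf_sqr => /orP[/eqP //|/eqP E]; move: T (r0); rewrite E; lra.
pose e : R * R := (C.1 - A.1, C.2 - A.2).
have dd : dot d d = 4 by rewrite /dot /d /=; lra.
have de : dot d e = 2 by rewrite /dot /d /e /=; lra.
have ce : cross d e = 2 * r by rewrite -TE /cross /d /e /turn /=; ring.
have C1 : C.1 = A.1 + d.1 / 2 - r / 2 * d.2.
  have : 4 * e.1 = dot d e * d.1 - cross d e * d.2 by rewrite -dd /dot /cross; ring.
  by rewrite de ce /e /=; lra.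
have C2 : C.2 = A.2 + d.2 / 2 + r / 2 * d.1.
  have : 4 * e.2 = dot d e * d.2 + cross d e * d.1 by rewrite -dd /dot /cross; ring.
  by rewrite de ce /e /=; lra.
have B1 : B.1 = A.1 + d.1 by rewrite /d /=; ring.
have B2 : B.2 = A.2 + d.2 by rewrite /d /=; ring.
clearbody d.
pose p : R * R := (- d.1 / 2 + r / 6 * d.2, - d.2 / 2 - r / 6 * d.1).
have pp : dot p p = 4 / 3.
  transitivity (dot d d * (1 / 4 + r ^+ 2 / 36)); last by rewrite dd r2; field.
  by rewrite /dot /p /=; field.
exists (A.1 - p.1, A.2 - p.2), (r / 2 * p.1, r / 2 * p.2); split.
  transitivity (r ^+ 2 / 4 * dot p p); last by rewrite pp r2; field.
  by rewrite /dot /=; field.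
move=> Z ZA ZB ZC j j3.
have cE (w : R * R) : disk_center w = (2 * r / 3 * w.1, 2 * r / 3 * w.2).
  by rewrite /disk_center /frame; congr pair; rewrite mul0r mul0r ?subr0 ?addr0.
have r3 : r ^+ 3 = 3 * r by rewrite exprS r2 mulrC.
have tr (X Y : R * R) : Z X -> Y.1 = X.1 -> Y.2 = X.2 -> Z Y.
  by case: X Y => [x1 x2] [y1 y2] ZX /= -> ->.
case: j j3 => [|[|[|//]]] _; rewrite cE /axis /iter ?turn120_twice /turn120 /frame /= -/r.
- apply: (tr _ _ ZA) => /=.
  + transitivity (A.1 - p.1 + r ^+ 2 / 3 * p.1); [by rewrite /p /=;
    field | by rewrite r2; field].
  + transitivity (A.2 - p.2 + r ^+ 2 / 3 * p.2); [by rewrite /p /=;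
    field | by rewrite r2; field].
- apply: (tr _ _ ZB) => /=.
  + transitivity (A.1 - p.1 - r ^+ 2 / 6 * p.1 - r ^+ 3 / 6 * p.2);
    first by rewrite /p /=; field.
    rewrite r3 r2 B1 /p /=; transitivity (A.1 + 3 / 4 * d.1 + r ^+ 2 / 12 * d.1);
      first by field.
    by rewrite r2; field.
  + transitivity (A.2 - p.2 - r ^+ 2 / 6 * p.2 + r ^+ 3 / 6 * p.1);
    first by rewrite /p /=; field.
    rewrite r3 r2 B2 /p /=; transitivity (A.2 + 3 / 4 * d.2 + r ^+ 2 / 12 * d.2);
      first by field.
    by rewrite r2; field.
- apply: (tr _ _ ZC) => /=.
  + transitivity (A.1 - p.1 - r ^+ 2 / 6 * p.1 + r ^+ 3 / 6 * p.2);
    first by rewrite /p /=; field.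
    rewrite r3 r2 C1 /p /=; transitivity (A.1
      + 3 / 4 * d.1 - r / 2 * d.2 - r ^+ 2 / 12 * d.1); first by field.
    by rewrite r2; field.
  + transitivity (A.2 - p.2 - r ^+ 2 / 6 * p.2 - r ^+ 3 / 6 * p.1);
    first by rewrite /p /=; field.
    rewrite r3 r2 C2 /p /=; transitivity (A.2 + 3 / 4 * d.2
      + r / 2 * d.1 - r ^+ 2 / 12 * d.2); first by field.
    by rewrite r2; field.
Qed.

(** The number of sector borders crossed when turning from a direction in sector
    j to one in sector k by less than half a turn. *)
Definition gap j k : nat := ((k + 3 - j) %% 3)%N.

Lemma axis_gap w j k : (j < 3)%N -> (k < 3)%N -> axis w k = axis (axis w j) (gap j k).
Proof.
by case: j => [|[|[|//]]] _; case: k => [|[|[|//]]] _;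
  rewrite /gap /axis //= !turn120_thrice.
Qed.

(** A border contributes 4 + 2 r / 3, twice the area of a strip of width 1 on a
    side of T and of a third of T, and 8 r / 3, the jump of the second summand of
    the potential there.  The corners of the cheapest trapezoids would allow
    2 r / 3 in place of 3 r / 4; the difference is the room needed to get by with a
    simple potential. *)
Lemma corner_bound w j k y z : dot w w = 1 -> (j < 3)%N -> (k < 3)%N ->
  -1 <= y <= 1 -> -1 <= z <= 1 ->
  let u := normal_at (axis w j) y in let v := normal_at (axis w k) z in
  let O := disk_center (axis w j) in let O' := disk_center (axis w k) in
  0 < cross u v -> [/\ gap j k = 0%N -> y < z, 0 <= leg_num O u O' v / cross u v,
    0 <= leg_num O' v O u / cross u v &
   potential (axis w k) z - potential (axis w j) y
     + (4 + 10 / 3 * r) * (gap j k)%:R - 3 / 4 * r <=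
  (leg_num O u O' v * (1 + dot O u) + leg_num O' v O u * (1 + dot O' v)) / cross u v].
Proof.
move=> w1 j3 k3 y1 z1; rewrite (axis_gap w j3 k3).
have W1 := axis_unit j w1; move: (axis w j) W1 => W W1.
have : (gap j k < 3)%N by rewrite ltn_mod.
case: (gap j k) => [|[|[|//]]] _ /= S.
- by have [yz h1 h2 h3] := corner_bound0 W1 y1 z1 S; split => //; move: h3;
  rewrite -/r; lra.
- by have [h1 h2 h3] := corner_bound1 W1 y1 z1 S; split => //; move: h3;
  rewrite -/r /turn120; lra.
- rewrite !turn120_twice in S *.
  by have [h1 h2 h3] := corner_bound2 W1 y1 z1 S; split => //; move: h3; rewrite -/r; lra.
Qed.

(** The sum is a multiple of 3, as the turn closes up. *)
Lemma gap_sum a b c d : (a < 3)%N -> (b < 3)%N -> (c < 3)%N -> (d < 3)%N ->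
  (3 <= gap a b + gap b c + gap c d + gap d a)%N \/
  [/\ gap a b = 0, gap b c = 0, gap c d = 0 & gap d a = 0]%N.
Proof.
by case: a => [|[|[|//]]] _; case: b => [|[|[|//]]] _; case: c => [|[|[|//]]] _;
  case: d => [|[|[|//]]] _; (by left) || by right.
Qed.

(** * Comparison with the tangent quadrilateral *)

Definition perp u : R * R := (- u.2, u.1).

(** Both sides are the intersection of the two tangents: for a vector D,
    [cross u v] D = (D.v) perp u - (D.u) perp v, applied to the difference of the
    touching points. *)
Lemma tangent_vertex O u O' v : dot u u = 1 -> dot v v = 1 -> cross u v != 0 ->
  let x := leg_num O u O' v / cross u v in let y := leg_num O' v O u / cross u v in
  (O.1 + u.1 + x * (perp u).1 = O'.1 + v.1 - y * (perp v).1) /\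
  (O.2 + u.2 + x * (perp u).2 = O'.2 + v.2 - y * (perp v).2).
Proof.
move=> u1 v1 S0 x y; split; apply: (mulIf S0); rewrite /x /y /perp /=.
- transitivity ((O.1 + u.1) * cross u v - leg_num O u O' v * u.2); first by field.
  transitivity ((O'.1 + v.1) * cross u v + leg_num O' v O u * v.2); last by field.
  rewrite /leg_num -{1}v1 -u1 /cross /dot; ring.
- transitivity ((O.2 + u.2) * cross u v + leg_num O u O' v * u.1); first by field.
  transitivity ((O'.2 + v.2) * cross u v - leg_num O' v O u * v.1); last by field.
  rewrite /leg_num -{1}v1 -u1 /cross /dot; ring.
Qed.

Lemma edge_normal A B : A != B ->
  exists u l, [/\ dot u u = 1, 0 < l &
    B.1 - A.1 = l * (perp u).1 /\ B.2 - A.2 = l * (perp u).2].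
Proof.
move=> AB; pose n := (B.1 - A.1) ^+ 2 + (B.2 - A.2) ^+ 2.
have n0 : 0 < n.
  rewrite lt_neqAle addr_ge0 ?sqr_ge0 // andbT eq_sym paddr_eq0 ?sqr_ge0 //.
  apply: contra AB; rewrite !sqrf_eq0 !subr_eq0 => /andP[/eqP e1 /eqP e2].
  by apply/eqP; rewrite [A]surjective_pairing [B]surjective_pairing e1 e2.
pose l := Num.sqrt n; have l0 : 0 < l by rewrite sqrtr_gt0.
have l1 : l != 0 by rewrite gt_eqF.
exists ((B.2 - A.2) / l, - ((B.1 - A.1) / l)), l; split => //.
  transitivity (n / l ^+ 2); first by rewrite /dot /n /=; field.
  by rewrite sqr_sqrtr ?(ltW n0) // divff ?gt_eqF.
by rewrite /perp /=; split; field.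
Qed.

(** The point of the disk that is extreme in the direction u has to lie on the
    inner side of the line AB. *)
Lemma support_unit_disk (X : set (R * R)) A B O u l : dot u u = 1 -> 0 < l ->
  B.1 - A.1 = l * (perp u).1 -> B.2 - A.2 = l * (perp u).2 ->
  X `<=` leftof A B -> unit_disk O `<=` X -> 1 + dot O u <= dot A u.
Proof.
move=> u1 l0 e1 e2 XL DX.
have : leftof A B (O.1 + u.1, O.2 + u.2).
  apply/XL/DX; rewrite /unit_disk /eucl_dist /=.
  have -> : (O.1 - (O.1 + u.1)) ^+ 2 + (O.2 - (O.2
    + u.2)) ^+ 2 = dot u u by rewrite /dot; ring.
  by rewrite u1 sqrtr1.
rewrite /leftof /turn /= e1 e2.
have -> : l * (perp u).1 * (O.2 + u.2 - B.2) - l * (perp u).2 * (O.1 + u.1 - B.1) =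
  l * (dot A u - (1 + dot O u)).
  have -> : B.1 = A.1 + l * (perp u).1 by lra.
  have -> : B.2 = A.2 + l * (perp u).2 by lra.
  by rewrite -u1 /perp /dot /=; ring.
by rewrite pmulr_rge0 // subr_ge0.
Qed.

(** The sides of the two quadrilaterals have the same normals u_i and lengths l_i
    and m_i.  Both sums of the conclusion are twice an area, and by symmetry of
    the mixed area the sums of l_i dot B_i u_i and of m_i dot A_i u_i agree; it
    lies between the two. *)
Lemma mixed_area_le (A1 A2 A3 A4 B1 B2 B3 B4 u1 u2 u3 u4 : R * R)
    (l1 l2 l3 l4 m1 m2 m3 m4 : R) :
  let side A B l u := B.1 - A.1 = l * (perp u).1 /\ B.2 - A.2 = l * (perp u).2 in
  side A1 A2 l1 u1 -> side A2 A3 l2 u2 -> side A3 A4 l3 u3 -> side A4 A1 l4 u4 ->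
  side B1 B2 m1 u1 -> side B2 B3 m2 u2 -> side B3 B4 m3 u3 -> side B4 B1 m4 u4 ->
  0 <= l1 -> 0 <= l2 -> 0 <= l3 -> 0 <= l4 -> 0 <= m1 -> 0 <= m2 -> 0 <= m3 -> 0 <= m4 ->
  dot B1 u1 <= dot A1 u1 -> dot B2 u2 <= dot A2 u2 -> dot B3 u3 <= dot A3 u3 ->
    dot B4 u4 <= dot A4 u4 ->
  m1 * dot B1 u1 + m2 * dot B2 u2 + m3 * dot B3 u3 + m4 * dot B4 u4 <=
  l1 * dot A1 u1 + l2 * dot A2 u2 + l3 * dot A3 u3 + l4 * dot A4 u4.
Proof.
move=> side [a1 a1'] [a2 a2'] [a3 a3'] [a4 a4'] [b1 b1'] [b2 b2'] [b3 b3'] [b4 b4'].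
move=> l10 l20 l30 l40 m10 m20 m30 m40 h1 h2 h3 h4.
have E : m1 * dot A1 u1 + m2 * dot A2 u2 + m3 * dot A3 u3 + m4 * dot A4 u4 =
  l1 * dot B1 u1 + l2 * dot B2 u2 + l3 * dot B3 u3 + l4 * dot B4 u4.
  have e (A B X Y u : R * R) (l m : R) : side A B l u -> side X Y m u ->
     m * dot A u - l * dot X u = cross B Y - cross A X.
    move=> [h h'] [k k'].
    have -> : B = (A.1 + l * (perp u).1, A.2 + l * (perp u).2).
      by rewrite -h -h' [LHS]surjective_pairing; congr pair; ring.
    have -> : Y = (X.1 + m * (perp u).1, X.2 + m * (perp u).2).
      by rewrite -k -k' [LHS]surjective_pairing; congr pair; ring.
    by rewrite /cross /dot /perp /=; ring.
  have := e _ _ _ _ _ _ _ (conj a1 a1') (conj b1 b1').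
  have := e _ _ _ _ _ _ _ (conj a2 a2') (conj b2 b2').
  have := e _ _ _ _ _ _ _ (conj a3 a3') (conj b3 b3').
  have := e _ _ _ _ _ _ _ (conj a4 a4') (conj b4 b4').
  clear; lra.
have g1 := ler_wpM2l l10 h1; have g2 := ler_wpM2l l20 h2.
have g3 := ler_wpM2l l30 h3; have g4 := ler_wpM2l l40 h4.
have f1 := ler_wpM2l m10 h1; have f2 := ler_wpM2l m20 h2.
have f3 := ler_wpM2l m30 h3; have f4 := ler_wpM2l m40 h4.
lra.
Qed.

Lemma supporting_side (X : set (R * R)) g w A B : dot w w = 1 -> A != B ->
  X `<=` leftof A B ->
  (forall j, (j < 3)%N ->
    unit_disk (g.1 + (disk_center (axis w j)).1, g.2 + (disk_center (axis w j)).2)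
      `<=` X) ->
  exists u l j y, [/\ dot u u = 1 /\ 0 < l,
    B.1 - A.1 = l * (perp u).1 /\ B.2 - A.2 = l * (perp u).2,
     (j < 3)%N /\ -1 <= y <= 1, u = normal_at (axis w j) y &
     1 + dot (disk_center (axis w j)) u <= dot (A.1 - g.1, A.2 - g.2) u].
Proof.
move=> w1 AB XL DX; have [u [l [u1 l0 [e1 e2]]]] := edge_normal AB.
have [j [y [j3 y1 uE]]] := normal_at_exists w1 u1.
exists u, l, j, y; split => //.
by have := support_unit_disk u1 l0 e1 e2 XL (DX j j3); rewrite /dot /=; lra.
Qed.

Lemma turn_neq A B C : 0 < turn A B C -> A != B.
Proof. by move=> t; apply/eqP => E; move: t; rewrite E /turn; lra. Qed.

Lemma cross_gt0 A B C u v l m : 0 < l -> 0 < m -> 0 < turn A B C ->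
  B.1 - A.1 = l * (perp u).1 /\ B.2 - A.2 = l * (perp u).2 ->
  C.1 - B.1 = m * (perp v).1 /\ C.2 - B.2 = m * (perp v).2 -> 0 < cross u v.
Proof.
move=> l0 m0 t [e1 e2] [f1 f2]; move: t; rewrite /turn e1 e2 f1 f2.
have -> : l * (perp u).1 * (m * (perp v).2) - l * (perp u).2 * (m * (perp v).1) =
  l * m * cross u v.
  by rewrite /perp /cross /=; ring.
by rewrite pmulr_rgt0 // mulr_gt0.
Qed.

(** B is the corner between the sides with normals u and v of a quadrilateral
    tangent to the disks; s and t are the lengths of the tangents from it to the
    touching points. *)
Lemma corner_vertex w j k y z u v : dot w w = 1 -> (j < 3)%N -> (k < 3)%N ->
  -1 <= y <= 1 -> -1 <= z <= 1 -> u = normal_at (axis w j) y ->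
    v = normal_at (axis w k) z -> 0 < cross u v ->
  let O := disk_center (axis w j) in let O' := disk_center (axis w k) in
  exists B s t, [/\ gap j k = 0%N -> y < z, 0 <= s /\ 0 <= t,
    B.1 = O.1 + u.1 + s * (perp u).1 /\ B.2 = O.2 + u.2 + s * (perp u).2,
    B.1 = O'.1 + v.1 - t * (perp v).1 /\ B.2 = O'.2 + v.2 - t * (perp v).2 &
    potential (axis w k) z - potential (axis w j) y
     + (4 + 10 / 3 * r) * (gap j k)%:R - 3 / 4 * r <=
    s * (1 + dot O u) + t * (1 + dot O' v)].
Proof.
move=> w1 j3 k3 y1 z1 uE vE S O O'.
have u1 : dot u u = 1 by rewrite uE normal_at_unit // axis_unit.
have v1 : dot v v = 1 by rewrite vE normal_at_unit // axis_unit.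
have S0 : cross u v != 0 by rewrite gt_eqF.
have [T1 T2] := tangent_vertex O O' u1 v1 S0.
move: (S); rewrite {1}uE {1}vE => S'.
have := corner_bound w1 j3 k3 y1 z1 S'; rewrite -uE -vE => -[yz s0 t0 bound].
exists (O.1 + u.1 + leg_num O u O' v / cross u v * (perp u).1,
  O.2 + u.2 + leg_num O u O' v / cross u v * (perp u).2).
exists (leg_num O u O' v / cross u v), (leg_num O' v O u / cross u v); split => //.
by apply: le_trans bound _; rewrite le_eqVlt; apply/orP; left; apply/eqP; field.
Qed.

(** The B_i of the proof are the vertices of the tangent quadrilateral, relative to
    the centroid g of the centres.  If no border were crossed, all normals would
    lie in one sector, each being further along than the one before it, which
    cannot close up. *)
Lemma shoelace_packed_ge (A1 A2 A3 A4 O1 O2 O3 : R * R) : ccw A1 A2 A3 A4 ->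
  efficiently_packed O1 O2 O3 -> contains_disks (quad A1 A2 A3 A4) O1 O2 O3 ->
  12 + 7 * r <= turn A1 A2 A3 + turn A3 A4 A1.
Proof.
move=> cc /packed_centroid_frame[g [w [w1 HZ]]] [D1 D2 D3].
have DX := HZ (fun O => unit_disk O `<=` quad A1 A2 A3 A4) D1 D2 D3.
have := quad_halfplanes cc; case: (cc) => t1 t2 t3 t4 QE.
have L1 : quad A1 A2 A3 A4 `<=` leftof A1 A2 by rewrite QE => P [[]].
have L2 : quad A1 A2 A3 A4 `<=` leftof A2 A3 by rewrite QE => P [[]].
have L3 : quad A1 A2 A3 A4 `<=` leftof A3 A4 by rewrite QE => P [_ []].
have L4 : quad A1 A2 A3 A4 `<=` leftof A4 A1 by rewrite QE => P [_ []].
have [u1 [l1 [j1 [y1 [[n1 l10] a1 [k1 b1] e1 s1]]]]] :=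
  supporting_side w1 (turn_neq t1) L1 DX.
have [u2 [l2 [j2 [y2 [[n2 l20] a2 [k2 b2] e2 s2]]]]] :=
  supporting_side w1 (turn_neq t2) L2 DX.
have [u3 [l3 [j3 [y3 [[n3 l30] a3 [k3 b3] e3 s3]]]]] :=
  supporting_side w1 (turn_neq t3) L3 DX.
have [u4 [l4 [j4 [y4 [[n4 l40] a4 [k4 b4] e4 s4]]]]] :=
  supporting_side w1 (turn_neq t4) L4 DX.
have [B2 [x1 [z2 [g1 [x10 z20] p1 q2 c1]]]] := corner_vertex w1 k1 k2 b1 b2 e1 e2
  (cross_gt0 l10 l20 t1 a1 a2).
have [B3 [x2 [z3 [g2 [x20 z30] p2 q3 c2]]]] := corner_vertex w1 k2 k3 b2 b3 e2 e3
  (cross_gt0 l20 l30 t2 a2 a3).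
have [B4 [x3 [z4 [g3 [x30 z40] p3 q4 c3]]]] := corner_vertex w1 k3 k4 b3 b4 e3 e4
  (cross_gt0 l30 l40 t3 a3 a4).
have [B1 [x4 [z1 [g4 [x40 z10] p4 q1 c4]]]] := corner_vertex w1 k4 k1 b4 b1 e4 e1
  (cross_gt0 l40 l10 t4 a4 a1).
have side (O u B B' : R * R) (x z : R) :
   B.1 = O.1 + u.1 - z * (perp u).1 /\ B.2 = O.2 + u.2 - z * (perp u).2 ->
   B'.1 = O.1 + u.1 + x * (perp u).1 /\ B'.2 = O.2 + u.2 + x * (perp u).2 ->
   B'.1 - B.1 = (x + z) * (perp u).1 /\ B'.2 - B.2 = (x + z) * (perp u).2.
  by move=> [-> ->] [-> ->]; split; ring.
have height (O u B : R * R) (z : R) : dot u u = 1 ->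
  B.1 = O.1 + u.1 - z * (perp u).1 /\ B.2 = O.2 + u.2 - z * (perp u).2 ->
   dot B u = 1 + dot O u.
  by move=> n [h h']; rewrite -n /dot h h' /perp /=; ring.
pose tr (A : R * R) : R * R := (A.1 - g.1, A.2 - g.2).
have trs A B l u : B.1 - A.1 = l * (perp u).1 /\ B.2 - A.2 = l * (perp u).2 ->
  (tr B).1 - (tr A).1 = l * (perp u).1 /\ (tr B).2 - (tr A).2 = l * (perp u).2.
  by move=> [<- <-]; split; rewrite /tr /=; ring.
have M := mixed_area_le (trs _ _ _ _ a1) (trs _ _ _ _ a2) (trs _ _ _ _ a3) (trs _ _ _ _ a4)
  (side _ _ _ _ _ _ q1 p1) (side _ _ _ _ _ _ q2 p2)
  (side _ _ _ _ _ _ q3 p3) (side _ _ _ _ _ _ q4 p4)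
  (ltW l10) (ltW l20) (ltW l30) (ltW l40)
  (addr_ge0 x10 z10) (addr_ge0 x20 z20) (addr_ge0 x30 z30) (addr_ge0 x40 z40).
rewrite (height _ _ _ _ n1 q1) (height _ _ _ _ n2 q2)
  (height _ _ _ _ n3 q3) (height _ _ _ _ n4 q4) in M.
have {}M := M s1 s2 s3 s4.
have LA A B l u : B.1 - A.1 = l * (perp u).1 /\ B.2 - A.2 = l * (perp u).2 ->
   l * dot (tr A) u = (tr A).1 * (B.2 - A.2) - (tr A).2 * (B.1 - A.1).
  by move=> [-> ->]; rewrite /perp /dot /=; ring.
rewrite (LA _ _ _ _ a1) (LA _ _ _ _ a2) (LA _ _ _ _ a3) (LA _ _ _ _ a4) in M.
have G : 3 <= (gap j1 j2)%:R + (gap j2 j3)%:R + (gap j3 j4)%:R + (gap j4 j1)%:R :> R.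
  rewrite -!natrD ler_nat.
  have [//|[h1 h2 h3 h4]] := gap_sum k1 k2 k3 k4.
  by move: (g1 h1) (g2 h2) (g3 h3) (g4 h4); clear; lra.
have G' : 0 <= (4 + 10 / 3 * r) * ((gap j1 j2)%:R + (gap j2 j3)%:R + (gap j3 j4)%:R
  + (gap j4 j1)%:R - 3).
  by rewrite mulr_ge0 ?subr_ge0 // addr_ge0 // mulr_ge0 // ltW.
have T : turn A1 A2 A3 + turn A3 A4 A1 =
  (tr A1).1 * (A2.2 - A1.2) - (tr A1).2 * (A2.1 - A1.1) +
  ((tr A2).1 * (A3.2 - A2.2) - (tr A2).2 * (A3.1 - A2.1)) +
  ((tr A3).1 * (A4.2 - A3.2) - (tr A3).2 * (A4.1 - A3.1)) +
  ((tr A4).1 * (A1.2 - A4.2) - (tr A4).2 * (A1.1 - A4.1)).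
  by rewrite /turn /tr /=; ring.
rewrite T; move: M c1 c2 c3 c4 G'; clear; lra.
Qed.

End Main.

Theorem theorem6 (R : realType) (M N K L : plane R) (Pstar : set (plane R))
    (hMNKL : smallest_quadrilateral M N K L)
    (hPstar : linear_packing_rectangle Pstar) :
  (area Pstar < area (quad M N K L))%E.
Proof.
have [A [B [C [D [rect -> _]]]]] := hPstar.
have [convex [c1 [c2 [c3 [packed disks]]]] _] := hMNKL.
have cc := convex_ccw convex.
have -> : area (quad A B C D) = (2 * 6)%:E by exact: area_rectangle rect.
have r7 : 12 < 7 * Num.sqrt (3 : R).
  have r0 := sqrt3_gt0 R; have r2 := sqrt3_sqr R.
  rewrite -ltr_sqr ?nnegrE ?exprMn ?r2 //; lra.
case: cc => cc; last rewrite -quad_rev in disks *.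
  rewrite area_quad // lte_fin.
  by have := shoelace_packed_ge cc packed disks; lra.
rewrite area_quad // lte_fin.
by have := shoelace_packed_ge cc packed disks; lra.
Qed.
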